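(* Let $K$ be a totally real number field and let $L$ be an étale $\mathbb Q$-algebra. Any $\mathbb Z$-linear map $A:\mathcal O_K\to\mathcal O_L$ with $A(\mathcal O_K^\times)\subseteq\mathcal O_L^\times$ is of the form $A=M_\varepsilon\circ\tau$ for (the restriction to $\mathcal O_K$ of) a $\mathbb Q$-algebra homomorphism $\tau:K\to L$ and a unit $\varepsilon\in\mathcal O_L^\times$, where $M_\varepsilon(x)=\varepsilon x$.
   Context: An étale $\mathbb Q$-algebra is a cartesian product $L=L_1\times\cdots\times L_s$ of finitely many number fields; its ring of integers is $\mathcal O_L=\prod_i\mathcal O_{L_i}$. *)

(* Defs.v *)
From HB Require Import structures.
From mathcomp Require Import all_boot all_order all_algebra all_field.
From mathcomp Require Import boolp reals.
From mathcomp Require Import complex.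

Set Implicit Arguments.
Unset Strict Implicit.
Unset Printing Implicit Defensive.

Import GRing.Theory.
Local Open Scope ring_scope.

(* Number fields are the objects of [fieldExtType rat]. *)

(* All complex embeddings have real image, C being R[i]; ring morphisms from
   a field are injective, so {rmorphism K -> R[i]} is the set of embeddings. *)
Definition totally_real (R : realType) (K : fieldExtType rat) : Prop :=
  forall (sigma : {rmorphism K -> R[i]}) (x : K), complex.Im (sigma x) = 0.

Definition invertible (S : comPzRingType) (x : S) : Prop :=
  exists y : S, x * y = 1.

Section Integers.
Variable K : fieldExtType rat.

Definition integers : {pred K} :=
  [pred x | `[< integralOver (intr : int -> K) x >]].

Lemma integersP (x : K) :
  reflect (integralOver (intr : int -> K) x) (x \in integers).
Proof. exact: asboolP. Qed.

Fact integers_subring_closed : subring_closed integers.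
Proof.
split=> [|x y /integersP xi /integersP yi|x y /integersP xi /integersP yi];
  apply/integersP.
- exact: integral1.
- exact: integral_sub.
- exact: integral_mul.
Qed.

HB.instance Definition _ :=
  GRing.isSubringClosed.Build K integers integers_subring_closed.

Record ringOfIntegers : predArgType :=
  RingOfIntegers { integer_val :> K; _ : integer_val \in integers }.

HB.instance Definition _ := [isSub for integer_val].
HB.instance Definition _ := [Choice of ringOfIntegers by <:].
HB.instance Definition _ :=
  [SubChoice_isSubComNzRing of ringOfIntegers by <:].

End Integers.

Arguments integers : clear implicits.

Section Etale.
Variables (s : nat) (L : 'I_s -> fieldExtType rat).

(* The product of the L i; s = 0 gives the zero ring, which is why only
   possibly-zero ([Pz]) ring structures are used here. *)
Definition etale : Type := {dffun forall i : 'I_s, L i}.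
HB.instance Definition _ := Choice.on etale.
Implicit Types x y z : etale.

Definition etale_mk (f : forall i, L i) : etale := [ffun i => f i].
Definition etale_zero : etale := etale_mk (fun=> 0).
Definition etale_opp x : etale := etale_mk (fun i => - x i).
Definition etale_add x y : etale := etale_mk (fun i => x i + y i).
Definition etale_one : etale := etale_mk (fun=> 1).
Definition etale_mul x y : etale := etale_mk (fun i => x i * y i).
Definition etale_scale (a : rat) x : etale := etale_mk (fun i => a *: x i).

Fact etale_addA : associative etale_add.
Proof. by move=> x y z; apply/ffunP=> i; rewrite !ffunE addrA. Qed.
Fact etale_addC : commutative etale_add.
Proof. by move=> x y; apply/ffunP=> i; rewrite !ffunE addrC. Qed.
Fact etale_add0 : left_id etale_zero etale_add.
Proof. by move=> x; apply/ffunP=> i; rewrite !ffunE add0r. Qed.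
Fact etale_addN : left_inverse etale_zero etale_opp etale_add.
Proof. by move=> x; apply/ffunP=> i; rewrite !ffunE addNr. Qed.

HB.instance Definition _ := GRing.isZmodule.Build etale
  etale_addA etale_addC etale_add0 etale_addN.

Fact etale_mulA : associative etale_mul.
Proof. by move=> x y z; apply/ffunP=> i; rewrite !ffunE mulrA. Qed.
Fact etale_mulC : commutative etale_mul.
Proof. by move=> x y; apply/ffunP=> i; rewrite !ffunE mulrC. Qed.
Fact etale_mul1 : left_id etale_one etale_mul.
Proof. by move=> x; apply/ffunP=> i; rewrite !ffunE mul1r. Qed.
Fact etale_mulDl : left_distributive etale_mul etale_add.
Proof. by move=> x y z; apply/ffunP=> i; rewrite !ffunE mulrDl. Qed.

HB.instance Definition _ := GRing.Zmodule_isComPzRing.Build etale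
  etale_mulA etale_mulC etale_mul1 etale_mulDl.

Fact etale_scaleA a b x :
  etale_scale a (etale_scale b x) = etale_scale (a * b) x.
Proof. by apply/ffunP=> i; rewrite !ffunE scalerA. Qed.
Fact etale_scale1 : left_id 1 etale_scale.
Proof. by move=> x; apply/ffunP=> i; rewrite !ffunE scale1r. Qed.
Fact etale_scaleDr : right_distributive etale_scale +%R.
Proof. by move=> a x y; apply/ffunP=> i; rewrite !ffunE scalerDr. Qed.
Fact etale_scaleDl x : {morph etale_scale^~ x : a b / a + b}.
Proof. by move=> a b; apply/ffunP=> i; rewrite !ffunE scalerDl. Qed.

HB.instance Definition _ := GRing.Zmodule_isLmodule.Build rat etale
  etale_scaleA etale_scale1 etale_scaleDr etale_scaleDl.

Lemma etale1E i : (1 : etale) i = 1. Proof. exact: ffunE. Qed.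
Lemma etaleDE x y i : (x + y) i = x i + y i. Proof. exact: ffunE. Qed.
Lemma etaleNE x i : (- x) i = - x i. Proof. exact: ffunE. Qed.
Lemma etaleME x y i : (x * y) i = x i * y i. Proof. exact: ffunE. Qed.
Lemma etaleZE a x i : (a *: x) i = a *: x i. Proof. exact: ffunE. Qed.

Definition etale_integers : {pred etale} :=
  [pred x : etale | [forall i, x i \in integers (L i)]].

Fact etale_integers_subring_closed : subring_closed etale_integers.
Proof.
split=> [|x y /forallP xi /forallP yi|x y /forallP xi /forallP yi];
  apply/forallP=> i.
- by rewrite etale1E rpred1.
- by rewrite etaleDE etaleNE rpredB ?xi ?yi.
- by rewrite etaleME rpredM ?xi ?yi.
Qed.

HB.instance Definition _ :=
  GRing.isSubringClosed.Build etale etale_integers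
    etale_integers_subring_closed.

Record etaleRingOfIntegers : predArgType := EtaleRingOfIntegers
  { etale_integer_val :> etale; _ : etale_integer_val \in etale_integers }.

HB.instance Definition _ := [isSub for etale_integer_val].
HB.instance Definition _ := [Choice of etaleRingOfIntegers by <:].
HB.instance Definition _ := GRing.SubChoice_isSubComPzRing.Build
  etale etale_integers etaleRingOfIntegers (GRing.subringClosedP _).

End Etale.

(* Main.v *)
From HB Require Import structures.
Require Import Defs.
From mathcomp Require Import all_boot all_order all_algebra all_field.
From mathcomp Require Import boolp reals.
From mathcomp Require Import complex.
From mathcomp Require Import lra.

(* It suffices to show that F = A(1)^-1 A, extended to K -> L_i additively, is
   multiplicative. Composed with an embedding tau of L_i, F is a linear combination
   of the embeddings sigma of K. As K is totally real, the box principle (as in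
   Dirichlet's unit theorem) yields a unit u all of whose conjugates but one have
   absolute value < 1; then u^2 has degree [K : Q], so that the |sigma(u)| are pairwise
   distinct. The unit F(u^m) F(u^-m) has norm 1 or -1, while its image under tau grows at
   least like the m-th power of max |sigma(u)| / min |sigma(u)|, taken over the sigma
   occurring in tau o F. This ratio is thus 1 for every tau: tau o F is a multiple of a
   single sigma, and equal to it because F(1) = 1. *)

Set Implicit Arguments.
Unset Strict Implicit.
Unset Printing Implicit Defensive.

Import Order.TTheory GRing.Theory Num.Theory.
Local Open Scope ring_scope.
Local Open Scope complex_scope.

(** * Integrality over the integers in number fields *)

Lemma integral_rat_int (r : rat) :
  integralOver (intr : int -> rat) r -> exists N : int, r = N%:~R.
Proof.
case=> p p_monic pr0; suffices /intrP[N rN]: (ratr r : algC) \in Num.int.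
  exists N; apply: (@fmorph_inj _ _ (ratr : {rmorphism rat -> algC})).
  by rewrite [LHS]rN /= ratr_int.
apply: Cint_rat_Aint; first exact: Crat_rat.
apply: (@root_monic_Aint (map_poly intr p)).
- have -> : map_poly intr p = map_poly ratr (map_poly (intr : int -> rat) p) :> {poly algC}.
    by rewrite -map_poly_comp; apply: eq_map_poly => a /=; rewrite ratr_int.
  by rewrite fmorph_root.
- exact: monic_map.
- by apply/polyOverP=> i; rewrite coef_map intr_int.
Qed.

(** Let [p] be an integer polynomial of degree n+1 killing [x], with leading coefficient [l].
    Multiplying [p(x) = 0] by [l^n] gives a monic integer relation for [l x], so [d = l] works. *)
Lemma integral_clear_denom (K : fieldExtType rat) (x : K) :
  exists2 d : int, d != 0 & d%:~R * x \in integers K.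
Proof.
have [p0 p0_monic p0x] := alg_integral x.
have [p [a a0 Dp]] := rat_poly_scale p0.
have p_n0 : p != 0.
  by apply/eqP=> p_0; move: (monic_neq0 p0_monic); rewrite Dp p_0 rmorph0 scaler0 eqxx.
have {p0x} px : (map_poly (intr : int -> K) p).[x] = 0.
  suff -> : map_poly intr p = map_poly (in_alg K) (a%:~R *: p0) by
    rewrite map_polyZ hornerZ (rootP p0x) mulr0.
  rewrite Dp scalerA divff ?intr_eq0 // scale1r -map_poly_comp.
  by apply: eq_map_poly => b; rewrite /= -(rmorph_int (in_alg K)).
have inj_int : injective (intr : int -> K).
  move=> b c; rewrite -(rmorph_int (in_alg K) b) -(rmorph_int (in_alg K) c).
  by move/(fmorph_inj (in_alg K))/intr_inj.
have lc0 : lead_coef p != 0 by rewrite lead_coef_eq0.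
move: px; rewrite horner_coef size_map_inj_poly ?rmorph0 //.
rewrite polySpred // big_ord_recr /=.
(* If [p] were constant, [p(x)] would be its nonzero leading coefficient. *)
case sE : (size p).-1 => [|n].
  rewrite big_ord0 add0r expr0 mulr1 coef_map /= -sE -lead_coefE.
  by move/(inj_int _ 0)/eqP; rewrite (negPf lc0).
rewrite coef_map /= -sE -lead_coefE sE => px.
exists (lead_coef p) => //; apply/integersP.
set l := lead_coef p in lc0 px *.
(* q is l^n p(X/l). *)
pose q : {poly K} := 'X^(n.+1) + \poly_(i < n.+1) (l ^+ (n - i) * p`_i)%:~R.
apply: (@integral_root_monic _ _ _ _ q).
- by rewrite monicE lead_coefDl ?lead_coefXn // size_polyXn ltnS size_poly.
- rewrite rootE hornerD hornerXn horner_poly; apply/eqP.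
  rewrite -[RHS](mulr0 (l%:~R ^+ n)) -[X in _ = _ * X]px mulrDr mulr_sumr
    [RHS]addrC mulrA -exprSr -exprMn.
  congr (_ + _). apply: eq_bigr => -[i lt_in] _ /=; rewrite coef_map /= rmorphM rmorphXn /=.
  by rewrite exprMn -!mulrA mulrCA [RHS]mulrCA [_ * (_ * x ^+ i)]mulrA -exprD subnK.
- apply/(integral_poly (intr : {rmorphism int -> K})) => i.
  rewrite coefD coefXn coef_poly; apply: integral_add.
    exact: integral_nat.
  by case: ifP => _; [exact: integral_id | exact: integral0].
Qed.

(** * Embeddings of a number field *)

(** Each element is written as some q(theta) and sent to q(z); the vanishing hypothesis makes the
    value independent of q, hence compatible with differences and products. *)
Lemma embedding_of_root (K : fieldExtType rat) (C : numFieldType)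
    (theta : K) (z : C) :
    (forall x, exists q, x = (map_poly (in_alg K) q).[theta]) ->
    (forall q, (map_poly (in_alg K) q).[theta] = 0 ->
               (map_poly ratr q).[z] = 0) ->
  exists sigma : {rmorphism K -> C},
    forall q, sigma (map_poly (in_alg K) q).[theta] = (map_poly ratr q).[z].
Proof.
move=> gen vanish; have [q qE] := choice gen.
pose sigma x := (map_poly ratr (q x)).[z].
have sigmaE r x : x = (map_poly (in_alg K) r).[theta] ->
    sigma x = (map_poly ratr r).[z].
  move=> xE; apply/eqP; rewrite -subr_eq0 -hornerN -hornerD -rmorphB /=.
  by apply/eqP/vanish; rewrite rmorphB hornerD hornerN /= -qE -xE subrr.
have sigmaB : zmod_morphism sigma.
  move=> x y; rewrite (sigmaE (q x - q y)).
    by rewrite rmorphB hornerD hornerN.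
  by rewrite rmorphB hornerD hornerN /= -!qE.
have sigmaM : monoid_morphism sigma.
  split=> [|x y]; first by rewrite (sigmaE 1) ?rmorph1 ?hornerC.
  rewrite (sigmaE (q x * q y)) ?rmorphM ?hornerM //.
  by rewrite -!qE.
pose sA := GRing.isZmodMorphism.Build _ _ sigma sigmaB.
pose sM := GRing.isMonoidMorphism.Build _ _ sigma sigmaM.
exists (HB.pack sigma sA sM : {rmorphism K -> C}) => r.
exact: sigmaE.
Qed.

Section Embeddings.
Variables (K : fieldExtType rat) (C : numClosedFieldType).

(** In characteristic 0 there is a primitive element, and a nonzero integer multiple of it generates
    the same field. *)
Lemma integral_primitive_element :
  exists2 theta : K, theta \in integers K & <<1; theta>>%VS = fullv.
Proof.
have sepK : separable 1%AS {:K}%AS.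
  apply/separableP=> u _; apply: pcharf0_separable.
  exact: ftrans (pchar_lalg K) (pchar_num _).
have theta_gen := eq_adjoin_separable_generator sepK (sub1v _).
set theta := separable_generator _ _ in theta_gen.
have [d d0 dint] := integral_clear_denom theta.
exists (d%:~R * theta) => //; rewrite [RHS]theta_gen.
have dK : d%:~R = (d%:~R)%:A :> K by rewrite -(rmorph_int (in_alg K)).
apply/eqP; rewrite eqEsubv; apply/andP; split; apply/FadjoinP; split;
  rewrite ?subv_adjoin // dK mulr_algl.
  exact: memvZ (memv_adjoin 1%AS theta).
rewrite -{1}[theta](scalerK (a := d%:~R)) ?intr_eq0 //.
exact: memvZ (memv_adjoin 1%AS (d%:~R *: theta)).
Qed.

Definition embedding_matrix n (b : 'I_n -> K) (sigma : 'I_n -> {rmorphism K -> C}) :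
  'M[C]_n := \matrix_(i, j) sigma i (b j).

(** The [b j] are the powers of an integral primitive element and the [sigma i] send it to the
    distinct roots of its minimal polynomial, so the matrix is a transposed Vandermonde matrix. Its
    invertibility encodes the independence both of the [b j] over the rationals and of the [sigma i]
    over [C]. *)
Lemma embeddings_exist :
  exists n (b : 'I_n.+1 -> K) (sigma : 'I_n.+1 -> {rmorphism K -> C}),
    [/\ forall j, b j \in integers K,
        forall x, exists q : 'I_n.+1 -> rat, x = \sum_j q j *: b j &
        embedding_matrix b sigma \in unitmx].
Proof.
have [theta theta_int theta_gen] := integral_primitive_element.
have [/polyOver1P[p Dp] p_monic] := (minPolyOver 1 theta, monic_minPoly 1 theta).
have gen x : exists q, x = (map_poly (in_alg K) q).[theta].
  by apply/Fadjoin1_polyP; rewrite theta_gen memvf.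
have p_mon : p \is monic by rewrite Dp map_monic in p_monic.
have [zs zsE] := closed_field_poly_normal (map_poly (ratr : rat -> C) p).
rewrite lead_coef_map (monicP p_mon) rmorph1 scale1r in zsE.
have sep_p : separable_poly p.
  rewrite -(separable_map (in_alg K)) -Dp.
  suff : separable_element 1%AS theta by [].
  apply: pcharf0_separable.
  exact: ftrans (pchar_lalg K) (pchar_num _).
have zs_uniq : uniq zs.
  rewrite -separable_prod_XsubC -zsE.
  by rewrite (separable_map (ratr : {rmorphism rat -> C})).
have sz_zs : size zs = (size (minPoly 1 theta)).-1.
  by rewrite Dp size_map_poly -(size_map_poly (ratr : {rmorphism rat -> C}) p)
    zsE size_prod_XsubC.
rewrite size_minPoly /= in sz_zs.
have vanish i : (i < size zs)%N -> forall q, (map_poly (in_alg K) q).[theta] = 0 ->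
               (map_poly ratr q).[zs`_i] = 0.
  move=> lti q /rootP qt.
  have : p %| q.
    rewrite -(dvdp_map (in_alg K)) -Dp minPoly_dvdp //.
    by apply/polyOver1P; exists q.
  rewrite -(dvdp_map (ratr : {rmorphism rat -> C})) /= zsE.
  move=> pq; apply/rootP; rewrite -dvdp_XsubCl; apply: dvdp_trans pq.
  by rewrite dvdp_XsubCl root_prod_XsubC mem_nth.
have n_gt0 : (0 < adjoin_degree 1 theta)%N by [].
case Dn : (adjoin_degree 1 theta) n_gt0 sz_zs => [//|n] _ sz_zs.
have lt_zs (i : 'I_n.+1) : (i < size zs)%N by rewrite sz_zs.
have /choice[sigma sigmaE] := fun i => embedding_of_root gen (vanish _ (lt_zs i)).
have sigma_theta i : sigma i theta = zs`_i.
  by have := sigmaE i 'X; rewrite !map_polyX !hornerX.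
exists n, (fun j => theta ^+ j), sigma; split.
- by move=> j; rewrite rpredX.
- move=> x; have [q xE] := gen x; pose r := q %% p.
  (* The remainder [r] has degree at most n, so its coefficients are coordinates of [x] in the
     powers of [theta]. *)
  exists (fun j : 'I_n.+1 => r`_j); rewrite xE (divp_eq q p).
  rewrite rmorphD rmorphM /= hornerD hornerM -Dp minPolyxx mulr0 add0r.
  rewrite (@horner_coef_wide _ n.+1).
    by apply: eq_bigr => j _; rewrite coef_map /= mulr_algl.
  rewrite size_map_poly -ltnS (leq_trans (ltn_modpN0 _ _)) ?monic_neq0 //.
  by rewrite -(size_map_poly (in_alg K)) -Dp size_minPoly Dn.
- suff -> : embedding_matrix (fun j => theta ^+ j) sigma =
     (Vandermonde n.+1 (\row_i zs`_i))^T.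
    rewrite unitmx_tr unitmxE det_Vandermonde unitfE.
    apply/prodf_neq0=> i _; apply/prodf_neq0=> j ij.
    by rewrite !mxE subr_eq0 nth_uniq ?sz_zs // neq_ltn ij orbT.
  by apply/matrixP=> i j; rewrite !mxE rmorphXn sigma_theta.
Qed.

End Embeddings.

(** * Conjugates and norms *)

Lemma integralOver_fmorph (F G : fieldType) (f : {rmorphism F -> G}) (x : F) :
  integralOver (intr : int -> G) (f x) <-> integralOver (intr : int -> F) x.
Proof.
have fE p : map_poly intr p = map_poly f (map_poly (intr : int -> F) p).
  by rewrite -map_poly_comp; apply: eq_map_poly => a /=; rewrite rmorph_int.
by split=> -[p p_monic]; rewrite ?fE => px; exists p => //; move: px;
  rewrite ?fE fmorph_root.
Qed.

Lemma embedding_scale (K : fieldExtType rat) (C : numFieldType)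
    (sigma : {rmorphism K -> C}) q x : sigma (q *: x) = ratr q * sigma x.
Proof.
rewrite -mulr_algl rmorphM; congr (_ * _).
exact: (fmorph_eq_rat (sigma \o in_alg K)).
Qed.

Lemma deriv_prod_XsubC (F : idomainType) n (z : 'I_n -> F) k :
  (\prod_i ('X - (z i)%:P))^`().[z k] = \prod_(i | i != k) (z k - z i).
Proof.
rewrite (bigD1 k) //= derivM derivXsubC mul1r hornerD hornerM hornerXsubC.
rewrite subrr mul0r addr0 horner_prod; apply: eq_bigr => i _.
by rewrite hornerXsubC.
Qed.

Lemma char_poly_conj (F : fieldType) n (M A D : 'M[F]_n) :
  M \in unitmx -> M *m A = D *m M -> char_poly A = char_poly D.
Proof.
move=> Mu MA; have detM : \det (map_mx polyC M) != 0.
  by rewrite det_map_mx polyC_eq0 -unitfE -unitmxE.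
apply: (mulfI detM); rewrite /char_poly -det_mulmx mulrC -det_mulmx.
rewrite /char_poly_mx mulmxBr mulmxBl -!map_mxM MA.
by rewrite scalar_mxC.
Qed.

Section Frame.
Variables (K : fieldExtType rat) (C : numClosedFieldType) (n : nat).
Variables (b : 'I_n -> K) (sigma : 'I_n -> {rmorphism K -> C}).
Hypothesis b_gen : forall x, exists q : 'I_n -> rat, x = \sum_j q j *: b j.
Hypothesis sigma_unit : embedding_matrix b sigma \in unitmx.

(** The coefficients of a relation form a vector in the kernel of the embedding matrix. *)
Lemma coord_eq0 (q : 'I_n -> rat) : \sum_j q j *: b j = 0 -> forall j, q j = 0.
Proof.
move=> qb0; pose v : 'cV[C]_n := \col_j ratr (q j).
have : embedding_matrix b sigma *m v = 0.
  apply/matrixP=> i k; rewrite !mxE -[RHS](rmorph0 (sigma i)) -[in RHS]qb0 rmorph_sum.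
  by apply: eq_bigr => j _; rewrite !mxE embedding_scale mulrC.
move/(congr1 (mulmx (invmx (embedding_matrix b sigma)))).
rewrite mulKmx // mulmx0 => /matrixP v0 j.
by have /eqP := v0 j ord0; rewrite !mxE fmorph_eq0 => /eqP.
Qed.

(** Inverting the embedding matrix gives the only [c] for which the identity holds on the [b j];
    rational linearity extends it to [K]. *)
Lemma additive_decomp (phi : K -> C) :
    (forall x y, phi (x + y) = phi x + phi y) ->
    (forall q x, phi (q *: x) = ratr q * phi x) ->
  exists c : 'I_n -> C, forall x, phi x = \sum_i c i * sigma i x.
Proof.
move=> phiD phiZ.
pose c : 'rV[C]_n := \row_j phi (b j) *m invmx (embedding_matrix b sigma).
have cE j : phi (b j) = \sum_i c ord0 i * sigma i (b j).
  have /matrixP/(_ ord0 j) := mulmxKV sigma_unit (\row_j phi (b j)).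
  rewrite !mxE => <-; apply: eq_bigr => i _.
  by congr (_ * _); rewrite !mxE.
have phi0 : phi 0 = 0.
  by apply: (@addrI _ (phi 0)); rewrite -phiD !addr0.
exists (c ord0) => x; have [q ->] := b_gen x.
rewrite (big_morph phi phiD phi0).
transitivity (\sum_j \sum_i ratr (q j) * (c ord0 i * sigma i (b j))).
  by apply: eq_bigr => j _; rewrite phiZ cE mulr_sumr.
rewrite exchange_big; apply: eq_bigr => i _.
rewrite rmorph_sum mulr_sumr; apply: eq_bigr => j _.
by rewrite embedding_scale mulrCA.
Qed.

(** [chi] is the characteristic polynomial of multiplication by [x] in the basis [b]; the embedding
    matrix diagonalises it. *)
Lemma conjugate_poly x : exists chi : {poly rat},
  map_poly ratr chi = \prod_i ('X - (sigma i x)%:P).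
Proof.
have /choice[A AE] := fun j => b_gen (x * b j).
pose D := diag_mx (\row_i sigma i x).
exists (char_poly (\matrix_(k, j) A j k)); rewrite map_char_poly.
rewrite (char_poly_conj (D := D) sigma_unit).
  rewrite char_poly_trig ?diag_mx_is_trig //.
  by apply: eq_bigr => i _; rewrite !mxE eqxx mulr1n.
rewrite mul_diag_mx; apply/matrixP=> i j; rewrite !mxE -rmorphM AE rmorph_sum.
by apply: eq_bigr => k _; rewrite !mxE embedding_scale mulrC.
Qed.

(** Up to sign the product is the constant term of the rational polynomial of [conjugate_poly];
    being also integral, it is an integer. *)
Lemma norm_integral x : x \in integers K -> x != 0 ->
  exists2 N : int, N != 0 & \prod_i sigma i x = N%:~R.
Proof.
move=> /integersP x_int x0; have [chi chiE] := conjugate_poly x.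
pose r := (-1) ^+ n * chi.[0].
have rE : \prod_i sigma i x = ratr r.
  rewrite /r rmorphM rmorphXn rmorphN1 /= -horner_map /= rmorph0 chiE horner_prod.
  under [in RHS]eq_bigr => i _ do rewrite hornerXsubC sub0r.
  by rewrite prodrN cardT /= size_enum_ord signrMK.
have /integral_rat_int[N rN] : integralOver (intr : int -> rat) r.
  apply/(integralOver_fmorph (ratr : {rmorphism rat -> C})); rewrite /= -rE.
  elim/big_rec: _ => [|i y _ y_int]; first exact: integral1.
  by apply: integral_mul => //; apply/integralOver_fmorph.
exists N; last by rewrite rE rN ratr_int.
have : \prod_i sigma i x != 0 by apply/prodf_neq0=> i _; rewrite fmorph_eq0.
by rewrite rE rN ratr_int intr_eq0.
Qed.

(** Under [sigma i0] the quotient becomes the product of the other conjugates of [x]. *)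
Lemma norm_cofactor_integral x (N : int) (i0 : 'I_n) : x \in integers K -> x != 0 ->
  \prod_i sigma i x = N%:~R -> N%:~R / x \in integers K.
Proof.
move=> /integersP x_int x0 NE.
apply/integersP/(integralOver_fmorph (sigma i0)).
rewrite fmorph_div rmorph_int -NE (bigD1 i0) //= mulrC mulKf ?fmorph_eq0 //.
elim/big_rec: _ => [|i y _ y_int]; first exact: integral1.
by apply: integral_mul => //; apply/integralOver_fmorph.
Qed.

(* If two conjugates of w coincide then chi'(w) = 0, where chi is the product of
   the X - sigma i w; applying sigma k shows that sigma k w is not simple either. *)
Lemma simple_conjugate_distinct w k :
    (forall i, i != k -> sigma i w != sigma k w) ->
  injective (fun i => sigma i w).
Proof.
move=> simple_k i j wij; apply/eqP; apply: contraT => nij.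
have [chi chiE] := conjugate_poly w.
have chi'E l : sigma l (map_poly (in_alg K) chi^`()).[w] =
    \prod_(m | m != l) (sigma l w - sigma m w).
  rewrite -deriv_prod_XsubC -chiE -horner_map -map_poly_comp deriv_map.
  congr _.[_]; apply: eq_map_poly => q /=.
  exact: (fmorph_eq_rat (sigma l \o in_alg K)).
have : sigma k (map_poly (in_alg K) chi^`()).[w] != 0.
  by rewrite chi'E; apply/prodf_neq0=> l lk; rewrite subr_eq0 eq_sym simple_k.
rewrite fmorph_eq0 -(fmorph_eq0 (sigma i)) chi'E.
by rewrite (bigD1 j) 1?eq_sym //= -wij subrr mul0r eqxx.
Qed.

End Frame.

(** * Small elements and units of a totally real field *)

Section Pigeonhole.
Variables (R : realType) (K : fieldExtType rat) (n : nat).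
Variables (b : 'I_n.+1 -> K) (rho : 'I_n.+1 -> {rmorphism K -> R}).

Definition int_comb (a : 'I_n.+1 -> int) : K := \sum_j (a j)%:~R * b j.

Hypothesis int_comb_inj : forall a, int_comb a = 0 -> forall j, a j = 0.

Lemma int_combB a a' : int_comb a - int_comb a' = int_comb (fun j => a j - a' j).
Proof.
rewrite /int_comb -sumrB; apply: eq_bigr => j _.
by rewrite -mulrBl intrB.
Qed.

Lemma int_comb_bound : exists2 c : R, 0 < c &
  forall (T : nat) (a : 'I_n.+1 -> nat), (0 < T)%N -> (forall j, a j <= T)%N ->
  forall i, `|rho i (int_comb a)| < c * T%:R.
Proof.
(* The sum over [i] makes [c] uniform in the embedding; the summand 1 makes the bound strict. *)
pose c : R := 1 + \sum_i \sum_j `|rho i (b j)|.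
have sum_ge0 i : 0 <= \sum_j `|rho i (b j)| by apply: sumr_ge0.
exists c => [|T a T_gt0 a_le i].
  by rewrite ltr_pwDl // sumr_ge0.
apply: (@le_lt_trans _ _ ((\sum_j `|rho i (b j)|) * T%:R)).
  rewrite rmorph_sum mulr_suml (le_trans (ler_norm_sum _ _ _)) //.
  apply: ler_sum => j _; rewrite rmorphM rmorph_int normrM mulrC.
  by rewrite ler_wpM2l // ger0_norm ?ler0n // ler_nat.
rewrite ltr_pM2r ?ltr0n // /c [X in 1 + X](bigD1 i) //= addrCA -[ltLHS]addr0 ltrD2l.
by rewrite ltr_pwDl // sumr_ge0.
Qed.

(* The box principle on the (t^n + 1)^(n+1) combinations with coefficients in
   [0, t^n], sorted by all conjugates but the i0-th into t^(n+1) slots each. *)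
Lemma small_int_comb : exists2 c : R, 0 < c &
  forall (i0 : 'I_n.+1) (t : nat), (0 < t)%N ->
  exists a : 'I_n.+1 -> int,
    [/\ int_comb a != 0,
        forall i, i != i0 -> `|rho i (int_comb a)| <= c / t%:R &
        `|rho i0 (int_comb a)| <= c * t%:R ^+ n].
Proof.
have [c c_gt0 cP] := int_comb_bound; exists (2 * c); first by rewrite mulr_gt0.
move=> i0 t t_gt0; pose T := (t ^ n)%N.
have T_gt0 : (0 < T)%N by rewrite expn_gt0 t_gt0.
have cT_gt0 : 0 < c * T%:R by rewrite mulr_gt0 ?ltr0n.
have t_pos : 0 < t%:R :> R by rewrite ltr0n.
pose A := {ffun 'I_n.+1 -> 'I_T.+1}.
pose Y (a : A) := int_comb (fun j => nat_of_ord (a j)).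
have Y_lt a i : `|rho i (Y a)| < c * T%:R.
  by apply: cP => // j; rewrite -ltnS.
(* [pos] rescales the interval from -cT to cT onto that from 0 to tT = t^(n+1); a unit slot
   corresponds to the width 2c/t. *)
pose pos (a : A) i : R := (rho i (Y a) + c * T%:R) / (2 * c) * t%:R.
have pos_ge0 a i : 0 <= pos a i.
  have := Y_lt a i; rewrite ltr_norml => /andP[lo _].
  rewrite /pos mulr_ge0 ?ler0n // divr_ge0 ?mulr_ge0 ?ltW //.
  by lra.
have pos_lt a i : (Num.truncn (pos a i) < t ^ n.+1)%N.
  rewrite truncn_lt_nat // expnSr natrM ltr_pM2r //.
  rewrite ltr_pdivrMr ?mulr_gt0 // [ltRHS]mulrC -mulrA mulr_natl mulr2n ltrD2r.
  by apply: le_lt_trans (Y_lt a i); rewrite ler_norm.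
pose code (a : A) := [ffun i : 'I_n => Ordinal (pos_lt a (lift i0 i))].
(* There are only (t^(n+1))^n = T^(n+1) codes for (T+1)^(n+1) elements of [A]. *)
have /injectivePn[a [a' aa' code_aa']] : ~~ injectiveb code.
  apply/injectiveP => /leq_card; rewrite !card_ffun !card_ord -expnM.
  by rewrite mulnC expnM -/T leqNgt ltn_exp2r // ltnSn.
exists (fun j => (a j)%:Z - (a' j)%:Z); rewrite -int_combB -/(Y a) -/(Y a').
split=> [|i ii0|].
- apply: contra aa'; rewrite int_combB => /eqP/int_comb_inj aa'0.
  apply/eqP/ffunP=> j; apply/val_inj; have /eqP := aa'0 j.
  by rewrite subr_eq0 => /eqP[].
- have [j ij _] : {j | i = lift i0 j & unlift i0 i = Some j}.
    by apply: unlift_some; rewrite eq_sym.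
  rewrite {i ii0}ij.
  have tr : Num.truncn (pos a (lift i0 j)) = Num.truncn (pos a' (lift i0 j)).
    by have /ffunP/(_ j) := code_aa'; rewrite !ffunE => /(congr1 val).
  have : `|pos a (lift i0 j) - pos a' (lift i0 j)| <= 1.
    have /andP[lo hi] := truncn_itv (pos_ge0 a (lift i0 j)).
    have /andP[lo' hi'] := truncn_itv (pos_ge0 a' (lift i0 j)).
    rewrite -tr in lo' hi'; rewrite -!natr1 in hi hi'.
    rewrite ler_norml; apply/andP; split; lra.
  rewrite /pos -mulrBl -mulrBl opprD addrACA subrr addr0 -rmorphB.
  rewrite !normrM normfV (gtr0_norm t_pos) (gtr0_norm (_ : 0 < 2 * c)) ?mulr_gt0 //.
  by rewrite -ler_pdivlMr // mul1r ler_pdivrMr ?mulr_gt0 // mulrC.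
- rewrite rmorphB (le_trans (ler_normB _ _)) // -natrX -/T.
  rewrite -mulrA; have := Y_lt a i0; have := Y_lt a' i0; lra.
Qed.

End Pigeonhole.

Section RealUnits.
Variables (R : realType) (K : fieldExtType rat) (n : nat).
Variables (b : 'I_n.+1 -> K) (sigma : 'I_n.+1 -> {rmorphism K -> R[i]}).
Variable rho : 'I_n.+1 -> {rmorphism K -> R}.
Hypothesis b_int : forall j, b j \in integers K.
Hypothesis b_gen : forall x, exists q : 'I_n.+1 -> rat, x = \sum_j q j *: b j.
Hypothesis sigma_unit : embedding_matrix b sigma \in unitmx.
Hypothesis sigmaE : forall i x, sigma i x = (rho i x)%:C.

Let rcM : {rmorphism R -> R[i]} := real_complex R.

Lemma int_comb_coord_eq0 a : int_comb b a = 0 -> forall j, a j = 0.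
Proof.
move=> ab0 j; apply/eqP; rewrite -(intr_eq0 rat); apply/eqP.
apply: (coord_eq0 sigma_unit (q := fun j => (a j)%:~R)).
rewrite -[RHS]ab0; apply: eq_bigr => k _.
by rewrite -mulr_algl -(rmorph_int (in_alg K)).
Qed.

Lemma int_comb_integral a : int_comb b a \in integers K.
Proof. by apply: rpred_sum => j _; rewrite rpredM ?rpred_int ?b_int. Qed.

Lemma real_norm_integral x : x \in integers K -> x != 0 ->
  exists N : int, [/\ N != 0, \prod_i rho i x = N%:~R & N%:~R / x \in integers K].
Proof.
move=> x_int x0; have [N N0 NE] := norm_integral b_gen sigma_unit x_int x0.
exists N; split=> //.
  apply: (fmorph_inj rcM); rewrite rmorph_int -NE rmorph_prod.
  by apply: eq_bigr => i _; rewrite sigmaE.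
exact: norm_cofactor_integral ord0 x_int x0 NE.
Qed.

(** The norm of [x] is a nonzero integer of size at most [B], so it divides B!. Thus one multiple
    serves all elements of norm at most [B]. *)
Lemma dvd_fact_integral (B : nat) x : x \in integers K -> x != 0 ->
  \prod_i `|rho i x| <= B%:R -> B`!%:R / x \in integers K.
Proof.
move=> x_int x0 leB; have [N [N0 NE Nx_int]] := real_norm_integral x_int x0.
have /dvdnP[m mE] : (`|N| %| B`!)%N.
  apply: dvdn_fact; rewrite absz_gt0 N0 /= -(ler_nat R) natr_absz.
  by rewrite intr_norm -NE normr_prod.
have -> : B`!%:R = (m%:Z * sgz N)%:~R * N%:~R :> K.
  by rewrite mE -intrM -mulrA mulrC -abszEsg mulrC pmulrn PoszM.
by rewrite -mulrA rpredM ?rpred_int.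
Qed.

Definition small_norm (B : nat) (a : 'I_n.+1 -> int) :=
  int_comb b a != 0 /\ \prod_i `|rho i (int_comb b a)| <= B%:R.

(** The box principle bounds the norm by c t^n (c/t)^n = c^(n+1), independently of t. At each step t
    is taken large enough to push the conjugates other than the [i0]-th below the previous ones. *)
Lemma decreasing_small_norm (i0 : 'I_n.+1) : exists (B : nat) (a : nat -> 'I_n.+1 -> int),
  (forall k, small_norm B (a k)) /\
  forall k l, (k < l)%N -> forall i, i != i0 ->
    `|rho i (int_comb b (a l))| < `|rho i (int_comb b (a k))|.
Proof.
have [c c_gt0 cP] := small_int_comb rho int_comb_coord_eq0.
pose B := (Num.truncn (c ^+ n.+1)).+1.
have cB : c ^+ n.+1 <= B%:R.
  by have /andP[_ /ltW] := truncn_itv (exprn_ge0 n.+1 (ltW c_gt0)).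
have small t : (0 < t)%N -> exists a, small_norm B a /\
    forall i, i != i0 -> `|rho i (int_comb b a)| <= c / t%:R.
  move=> t_gt0; have [a [a0 a_small a_i0]] := cP i0 t t_gt0.
  exists a; split=> //; split=> //; apply: le_trans cB.
  rewrite (bigD1 i0) //=.
  have t_neq0 : t%:R != 0 :> R by rewrite pnatr_eq0 -lt0n.
  have -> : c ^+ n.+1 = (c * t%:R ^+ n) * (c / t%:R) ^+ n.
    by rewrite exprSr -mulrA -exprMn mulrCA divff // mulr1 mulrC.
  apply: ler_pM => //; first by apply: prodr_ge0.
  apply: (@le_trans _ _ (\prod_(i < n.+1 | i != i0) (c / t%:R))).
    by apply: ler_prod => i ii0; rewrite normr_ge0 a_small.
  by rewrite prodr_const cardC1 card_ord.
have step a : exists a', small_norm B a -> small_norm B a' /\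
    forall i, i != i0 -> `|rho i (int_comb b a')| < `|rho i (int_comb b a)|.
  have [[a0 _]|nga] := pselect (small_norm B a); last by exists a => /nga.
  (* Any t > s exceeds each summand, so c/t is below every conjugate of the current element in
     absolute value. *)
  pose s := \sum_i c / `|rho i (int_comb b a)|.
  have a_pos i : 0 < `|rho i (int_comb b a)| by rewrite normr_gt0 fmorph_eq0.
  have term_ge0 i : 0 <= c / `|rho i (int_comb b a)| by rewrite divr_ge0 // ltW.
  have s_ge0 : 0 <= s by apply: sumr_ge0.
  have [a' [a'_good a'_small]] := small (Num.truncn s).+1 isT.
  exists a' => _; split=> // i /a'_small /le_lt_trans; apply.
  rewrite ltr_pdivrMr ?ltr0n // mulrC -ltr_pdivrMr //.
  have /andP[_] := truncn_itv s_ge0; apply: le_lt_trans.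
  by rewrite /s (bigD1 i) //= lerDl sumr_ge0.
have [next nextP] := choice step.
have [a0 [a0_good _]] := small 1%N isT.
pose a k := iter k next a0.
have a_good k : small_norm B (a k).
  by elim: k => // k IH; have [] := nextP _ IH.
exists B, a; split=> // k l kl i ii0; elim: l kl => // l IH.
have [_ /(_ i ii0) dec] := nextP _ (a_good l).
rewrite ltnS leq_eqVlt => /predU1P[->//|/IH]; exact: lt_trans.
Qed.

(* Each member of a sequence of bounded norm divides its norm, hence B!, so the
   quotient of two members that are congruent modulo B! is a unit. *)
Lemma unit_contracting (i0 : 'I_n.+1) : exists u : K,
  [/\ u != 0, u \in integers K, u^-1 \in integers K &
      forall i, i != i0 -> `|rho i u| < 1].
Proof.
have [B [a [a_good a_dec]]] := decreasing_small_norm i0.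
pose Q := B`!; have Q_gt0 : (0 < Q)%N := fact_gt0 B.
have Q0 : Q%:Z != 0 by rewrite eqz_nat -lt0n.
have key_lt (z : int) : (`|(z %% Q)%Z| < Q)%N.
  by rewrite -ltz_nat gez0_abs ?modz_ge0 // ltz_pmod.
pose key k := [ffun j => Ordinal (key_lt (a k j))].
(* One index more than there are coefficient vectors modulo [Q]. *)
pose key' (k : 'I_#|{ffun 'I_n.+1 -> 'I_Q}|.+1) := key k.
have [k [l [kl key_kl]]] : exists k l, (k < l)%N /\ key k = key l.
  have /injectivePn[k [l kl key_kl]] : ~~ injectiveb key'.
    by apply/injectiveP => /leq_card; rewrite card_ord ltnn.
  have [lt_kl|lt_lk|/val_inj eq_kl] := ltngtP k l.
  - by exists k, l.
  - by exists l, k.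
  - by rewrite eq_kl eqxx in kl.
pose x := int_comb b (a k); pose y := int_comb b (a l).
have [z yxE z_int] : exists2 z, y - x = Q%:R * z & z \in integers K.
  exists (int_comb b (fun j => ((a l j - a k j) %/ Q)%Z)); last exact: int_comb_integral.
  rewrite int_combB /int_comb mulr_sumr; apply: eq_bigr => j _.
  rewrite mulrA -[Q%:R]/(Q%:Z%:~R) -intrM [(Q%:Z * _)]mulrC divzK //.
  have /ffunP/(_ j) := key_kl; rewrite !ffunE => /(congr1 val) /= /eqP.
  by rewrite -eqz_nat !gez0_abs ?modz_ge0 // eq_sym eqz_mod_dvd.
have [x0 leBx] := a_good k; have [y0 leBy] := a_good l.
have Qx := dvd_fact_integral (int_comb_integral _) x0 leBx.
have Qy := dvd_fact_integral (int_comb_integral _) y0 leBy.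
rewrite -/x -/y in x0 y0 Qx Qy.
(* Here y/x = 1 + (Q/x) z and x/y = 1 - (Q/y) z, where Q/x and Q/y are integral. *)
exists (y / x); split.
- by rewrite mulf_neq0 ?invr_eq0.
- rewrite -(subrK x y) yxE mulrDl divff // mulrAC.
  by rewrite rpredD ?rpred1 // rpredM.
- rewrite invf_div -(subKr y x) yxE mulrBl divff // mulrAC.
  by rewrite rpredB ?rpred1 // rpredM.
- move=> i ii0; rewrite fmorph_div normf_div ltr_pdivrMr ?normr_gt0 ?fmorph_eq0 //.
  by rewrite mul1r a_dec.
Qed.

(** Since the conjugates are real, equal absolute values mean equal conjugates of [u ^+ 2]. The
    [ord0]-th of these is simple: a nonzero integral norm forces [|rho ord0 u|] to be at least 1,
    while all others are below 1. *)
Lemma unit_distinct_conjugates : exists u : K,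
  [/\ u != 0, u \in integers K, u^-1 \in integers K &
      injective (fun i => `|rho i u|)].
Proof.
have [u [u0 u_int uV_int u_small]] := unit_contracting ord0.
exists u; split=> // i j /(congr1 (fun r => r ^+ 2)).
rewrite !real_normK ?num_real // => uij.
apply: (simple_conjugate_distinct b_gen sigma_unit (w := u ^+ 2) (k := ord0)); last first.
  by rewrite /= !sigmaE 2!(rmorphXn (rho _)) uij.
move=> {i j uij}i i0; apply: contraTneq (u_small i i0).
rewrite !sigmaE => /(fmorph_inj rcM); rewrite !rmorphXn => /eqP.
rewrite eqf_sqr => /orP ui.
have -> : `|rho i u| = `|rho ord0 u| by case: ui => /eqP->; rewrite ?normrN.
rewrite -leNgt; have [N [N0 NE _]] := real_norm_integral u_int u0.
rewrite leNgt; apply/negP => u_lt1.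
have : 1 <= `|\prod_i rho i u|.
  by rewrite NE -intr_norm (ler_int R 1) -gtz0_ge1 normr_gt0.
rewrite normr_prod (bigD1 ord0) //= leNgt; apply/negP/negPn.
apply: le_lt_trans u_lt1; rewrite ler_piMr //; apply: prodr_ile1 => j j0.
by rewrite normr_ge0 ltW ?u_small.
Qed.

End RealUnits.

(** * Exponential sums *)

Section ComplexModulus.
Variable R : realType.
Implicit Types z w : R[i].

(** The norm on [R[i]] takes values in [R[i]]; this is the same number as an element of the ordered
    field [R]. *)
Definition modulus z : R := complex.Re `|z|.

Lemma modulusE z : `|z| = (modulus z)%:C.
Proof. by rewrite /modulus normc_def. Qed.

Lemma modulus_ge0 z : 0 <= modulus z.
Proof. by rewrite /modulus normc_def sqrtr_ge0. Qed.

Lemma modulusM : {morph modulus : z w / z * w}.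
Proof. by move=> z w; apply: complexI; rewrite rmorphM /= -!modulusE normrM. Qed.

Lemma modulusV : {morph modulus : z / z^-1}.
Proof. by move=> z; apply: complexI; rewrite fmorphV /= -!modulusE normfV. Qed.

Lemma modulusX m : {morph modulus : z / z ^+ m}.
Proof. by move=> z; apply: complexI; rewrite rmorphXn /= -!modulusE normrX. Qed.

Lemma modulus_eq0 z : (modulus z == 0) = (z == 0).
Proof. by rewrite -(fmorph_eq0 (real_complex R)) /= -modulusE normr_eq0. Qed.

Lemma modulus0 : modulus 0 = 0.
Proof. by apply/eqP; rewrite modulus_eq0. Qed.

Lemma modulus_gt0 z : (0 < modulus z) = (z != 0).
Proof. by rewrite lt0r modulus_ge0 andbT modulus_eq0. Qed.

Lemma modulus_sum (I : finType) (P : pred I) (f : I -> R[i]) :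
  modulus (\sum_(i | P i) f i) <= \sum_(i | P i) modulus (f i).
Proof.
by rewrite -lecR rmorph_sum /= -modulusE; exact: ler_norm_sum.
Qed.

Lemma modulus_prod (I : finType) (f : I -> R[i]) :
  modulus (\prod_i f i) = \prod_i modulus (f i).
Proof.
apply: complexI; rewrite rmorph_prod /= -modulusE normr_prod.
by apply: eq_bigr => i _; rewrite modulusE.
Qed.

Lemma modulusB_le z w : modulus z <= modulus (z + w) + modulus w.
Proof.
rewrite -lecR rmorphD /= -!modulusE -lerBlDr.
by have := lerB_normD z w.
Qed.

Lemma modulus_real (x : R) : modulus x%:C = `|x|.
Proof. by rewrite /modulus normc_def /= expr0n /= addr0 sqrtr_sqr. Qed.

End ComplexModulus.

Lemma geometric_small (R : realType) (r eps : R) : 0 <= r -> r < 1 -> 0 < eps ->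
  exists N : nat, forall m, (N <= m)%N -> r ^+ m <= eps.
Proof.
move=> r_ge0 r_lt1 eps_gt0; pose s := 1 - r.
have s_gt0 : 0 < s by rewrite subr_gt0.
(* A Bernoulli-type inequality, in product form so as to allow r = 0. *)
have bern m : r ^+ m * (1 + m%:R * s) <= 1.
  elim: m => [|m IH]; first by rewrite expr0 mul0r addr0 mulr1.
  apply: le_trans IH; rewrite exprSr -mulrA ler_wpM2l ?exprn_ge0 //.
  have m_ge0 : 0 <= m%:R :> R := ler0n _ m.
  (* With s = 1 - r, the two sides differ by exactly (m+1) s^2. *)
  have := mulr_ge0 (addr_ge0 m_ge0 ler01) (sqr_ge0 (1 - r)); rewrite /s -natr1; lra.
pose N := (Num.truncn (eps * s)^-1).+1; exists N => m le_Nm.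
have es_gt0 : 0 < eps * s by rewrite mulr_gt0.
have m_big : 1 <= m%:R * s * eps.
  rewrite -mulrA [s * _]mulrC -ler_pdivrMr // mul1r.
  have inv_ge0 : 0 <= (eps * s)^-1 by rewrite invr_ge0 ltW.
  have /andP[_ /ltW/le_trans] := truncn_itv inv_ge0; apply.
  by rewrite ler_nat.
have rm_ge0 : 0 <= r ^+ m by rewrite exprn_ge0.
have ms_ge0 : 0 <= m%:R * s by rewrite mulr_ge0 // ltW.
have : r ^+ m * 1 <= r ^+ m * (m%:R * s * eps) by rewrite ler_wpM2l.
have := bern m; nra.
Qed.

Section ExponentialSums.
Variables (R : realType) (n : nat).
Implicit Types c a : 'I_n -> R[i].

(** The [k]-th term dominates: for large m the others together amount to at most half of it. *)
Lemma exp_sum_lower_bound c a k : c k != 0 -> a k != 0 ->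
    (forall i, i != k -> c i != 0 -> modulus (a i) < modulus (a k)) ->
  exists N : nat, forall m, (N <= m)%N ->
    modulus (c k) / 2 * modulus (a k) ^+ m <= modulus (\sum_i c i * a i ^+ m).
Proof.
move=> ck ak dom; have ak_gt0 : 0 < modulus (a k) by rewrite modulus_gt0.
have ck_gt0 : 0 < modulus (c k) by rewrite modulus_gt0.
pose S := 1 + \sum_(i | i != k) modulus (c i).
have S_gt0 : 0 < S by rewrite ltr_pwDl // sumr_ge0 // => i _; apply: modulus_ge0.
(* Chosen so that [S * eps] is half of [modulus (c k)]; the 1 in [S] keeps it positive when there
   are no other terms. *)
pose eps := modulus (c k) / (2 * S).
have eps_gt0 : 0 < eps by rewrite divr_gt0 // mulr_gt0.
have /choice[N NP] : forall i, exists N, i != k -> forall m, (N <= m)%N ->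
    modulus (c i) * modulus (a i) ^+ m <= modulus (c i) * (eps * modulus (a k) ^+ m).
  move=> i; have [->|ik] := eqVneq i k; first by exists 0%N.
  have [->|ci] := eqVneq (c i) 0.
    by exists 0%N => _ m _; rewrite modulus0 !mul0r.
  have r_ge0 : 0 <= modulus (a i) / modulus (a k).
    by rewrite divr_ge0 ?modulus_ge0.
  have r_lt1 : modulus (a i) / modulus (a k) < 1.
    by rewrite ltr_pdivrMr // mul1r dom.
  have [N NP] := geometric_small r_ge0 r_lt1 eps_gt0.
  exists N => _ m /NP; rewrite expr_div_n ler_pdivrMr ?exprn_gt0 // => le_m.
  by rewrite ler_wpM2l ?modulus_ge0.
exists (\sum_i N i)%N => m le_m.
rewrite (bigD1 k) //=.
set E := \sum_(i | i != k) _.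
have E_le : modulus E <= modulus (c k) / 2 * modulus (a k) ^+ m.
  apply: le_trans (modulus_sum _ _) _.
  apply: (@le_trans _ _ (\sum_(i | i != k) modulus (c i) * (eps * modulus (a k) ^+ m))).
    apply: ler_sum => i ik; rewrite modulusM modulusX NP //.
    by apply: leq_trans le_m; rewrite (bigD1 i) //= leq_addr.
  rewrite -mulr_suml mulrA ler_wpM2r ?exprn_ge0 ?modulus_ge0 //.
  have <- : S * eps = modulus (c k) / 2.
    by rewrite /eps invfM mulrCA [S * _]mulrCA divff ?mulr1 // gt_eqF.
  by rewrite ler_wpM2r ?(ltW eps_gt0) // lerDr.
have := modulusB_le (c k * a k ^+ m) E; rewrite modulusM modulusX; lra.
Qed.

(** On the support of [c], the largest [a k] dominates the sum of positive powers and the smallest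
    [a k'] that of negative powers; distinct moduli make both dominations strict. *)
Lemma two_sided_lower_bound c a : (exists i, c i != 0) -> (forall i, a i != 0) ->
    injective (fun i => modulus (a i)) ->
  exists k k' D (N : nat), [/\ 0 < D, c k != 0,
    forall i, c i != 0 -> modulus (a k') <= modulus (a i) <= modulus (a k) &
    forall m, (N <= m)%N -> D * (modulus (a k) / modulus (a k')) ^+ m <=
      modulus (\sum_i c i * a i ^+ m) * modulus (\sum_i c i * (a i)^-1 ^+ m)].
Proof.
case=> i0 ci0 a0 a_inj.
have [k ck k_max] := @arg_maxP _ _ _ i0 (fun i => c i != 0) (fun i => modulus (a i)) ci0.
have [k' ck' k'_min] := @arg_minP _ _ _ i0 (fun i => c i != 0) (fun i => modulus (a i)) ci0.
have mod_lt i j : i != j -> modulus (a i) <= modulus (a j) -> modulus (a i) < modulus (a j).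
  move=> ij le_ij; rewrite lt_neqAle le_ij andbT.
  by apply: contra ij => /eqP/a_inj->.
have [N1 N1P] := @exp_sum_lower_bound c a k ck (a0 k) (fun i ik ci =>
  mod_lt _ _ ik (k_max i ci)).
have [||N2 N2P] := @exp_sum_lower_bound c (fun i => (a i)^-1) k' ck'.
- by rewrite invr_eq0.
- move=> i ik ci; rewrite !modulusV ltf_pV2 ?posrE ?modulus_gt0 //.
  by apply: mod_lt; [rewrite eq_sym | exact: k'_min].
exists k, k', (modulus (c k) / 2 * (modulus (c k') / 2)), (N1 + N2)%N.
split=> // [|i ci|m le_m].
- by rewrite mulr_gt0 // divr_gt0 ?modulus_gt0.
- by apply/andP; split; [apply: k'_min | apply: k_max].
- rewrite expr_div_n mulrACA -exprVn; apply: ler_pM.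
  + by rewrite mulr_ge0 ?divr_ge0 ?exprn_ge0 ?modulus_ge0.
  + by rewrite mulr_ge0 ?divr_ge0 ?exprn_ge0 ?invr_ge0 ?modulus_ge0.
  + by apply: N1P; apply: leq_trans le_m; rewrite leq_addr.
  + have := N2P m (leq_trans (leq_addl _ _) le_m).
    by rewrite modulusV.
Qed.

End ExponentialSums.

(** * Norms of units and multiplicativity of unit-preserving maps *)

Lemma embedding_additive_scale (K L : fieldExtType rat) (C : numFieldType) (F : {additive K -> L})
   (tau : {rmorphism L -> C}) q x : tau (F (q *: x)) = ratr q * tau (F x).
Proof. by rewrite (rat_linear (raddfB F)) embedding_scale. Qed.

(** The norm of [g^-1] is a nonzero integer, hence of modulus at least 1. *)
Lemma unit_norm (R : realType) (L : fieldExtType rat) d (b : 'I_d.+1 -> L)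
    (tau : 'I_d.+1 -> {rmorphism L -> R[i]}) (g : L) :
    (forall x, exists q : 'I_d.+1 -> rat, x = \sum_j q j *: b j) ->
    embedding_matrix b tau \in unitmx ->
    g != 0 -> g^-1 \in integers L -> \prod_j modulus (tau j g) <= 1.
Proof.
move=> b_gen tau_unit g0 gV_int.
have gV0 : g^-1 != 0 by rewrite invr_eq0.
have [N N0 NE] := norm_integral b_gen tau_unit gV_int gV0.
rewrite -modulus_prod.
have -> : \prod_i tau i g = (N%:~R)^-1.
  rewrite -NE -prodfV; apply: eq_bigr => i _.
  by rewrite fmorphV invrK.
rewrite modulusV invf_le1 ?modulus_gt0 ?intr_eq0 //.
rewrite -(rmorph_int (real_complex R)) /= modulus_real -intr_norm (ler_int R 1).
by rewrite -gtz0_ge1 normr_gt0.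
Qed.

Lemma unit_preserving_multiplicative (R : realType) (K L : fieldExtType rat)
    (F : {additive K -> L}) :
    totally_real R K -> F 1 = 1 ->
    (forall u, u != 0 -> u \in integers K -> u^-1 \in integers K ->
       F u != 0 /\ (F u)^-1 \in integers L) ->
  {morph F : x y / x * y}.
Proof.
move=> K_real F1 F_unit.
have [n [b [sigma [b_int b_gen sigma_unit]]]] := embeddings_exist K R[i].
have [d [e [tau [e_int e_gen tau_unit]]]] := embeddings_exist L R[i].
have /choice[rho sigmaE] : forall i, exists r : {rmorphism K -> R},
    forall x, sigma i x = (r x)%:C.
  move=> i; pose r x := complex.Re (sigma i x).
  have rE x : sigma i x = (r x)%:C.
    by rewrite /r; have := K_real (sigma i) x; case: (sigma i x) => ? ? /= ->.
  have rB : zmod_morphism r.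
    by move=> x y; apply: complexI; rewrite rmorphB /= -!rE rmorphB.
  have rM : monoid_morphism r.
    by split=> [|x y]; apply: complexI; rewrite ?rmorph1 ?rmorphM /= -!rE ?rmorph1 ?rmorphM.
  pose rA := GRing.isZmodMorphism.Build _ _ r rB.
  pose rMm := GRing.isMonoidMorphism.Build _ _ r rM.
  by exists (HB.pack r rA rMm : {rmorphism K -> R}).
have [u [u0 u_int uV_int u_inj]] := unit_distinct_conjugates b_int b_gen sigma_unit sigmaE.
have a_neq0 i : sigma i u != 0 by rewrite fmorph_eq0.
have a_inj : injective (fun i => modulus (sigma i u)).
  by move=> i j; rewrite !sigmaE !modulus_real; apply: u_inj.
have /choice[c cE] : forall j, exists c : 'I_n.+1 -> R[i],
    forall x, tau j (F x) = \sum_i c i * sigma i x.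
  move=> j; apply: (additive_decomp b_gen sigma_unit).
  - by move=> x y; rewrite raddfD rmorphD.
  - by move=> q x; apply: embedding_additive_scale.
have c_neq0 j : exists i, c j i != 0.
  apply/existsP; apply: contraT; rewrite negb_exists => /forallP c0.
  have /eqP := cE j 1; rewrite F1 rmorph1 big1 ?oner_eq0 // => i _.
  by have := c0 i; rewrite negbK => /eqP->; rewrite mul0r.
have /choice[k /choice[k' /choice[D /choice[N P]]]] := fun j =>
  two_sided_lower_bound (c_neq0 j) a_neq0 a_inj.
pose r j := modulus (sigma (k j) u) / modulus (sigma (k' j) u).
have a_gt0 i : 0 < modulus (sigma i u) by rewrite modulus_gt0.
have r_ge1 j : 1 <= r j.
  have [_ ck /(_ _ ck)/andP[le_k _] _] := P j.
  by rewrite ler_pdivlMr // mul1r.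
have D_gt0 j : 0 < D j by have [] := P j.
(* Pairing opposite powers makes the growth rate [r j] at least 1 at every embedding of [L], so no
   factor of the norm can offset a rate above 1. *)
pose g m := F (u ^+ m) * F (u ^- m).
have g_le1 m : \prod_j modulus (tau j (g m)) <= 1.
  have [um_int umV_int] : u ^+ m \in integers K /\ u ^- m \in integers K.
    by rewrite -exprVn !rpredX.
  have um0 : u ^+ m != 0 by rewrite expf_neq0.
  have [F0 FV] := F_unit _ um0 um_int umV_int.
  have [||F0' FV'] := F_unit (u ^- m) _ umV_int; rewrite ?invr_eq0 ?invrK //.
  apply: (unit_norm e_gen tau_unit); first by rewrite mulf_neq0.
  by rewrite invfM rpredM.
have g_ge m : (\sum_j N j <= m)%N ->
    forall j, D j * r j ^+ m <= modulus (tau j (g m)).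
  move=> le_m j; rewrite rmorphM modulusM !cE.
  under eq_bigr do rewrite rmorphXn.
  under [X in _ <= _ * modulus X]eq_bigr do rewrite -exprVn rmorphXn fmorphV.
  by have [_ _ _] := P j; apply; apply: leq_trans le_m; rewrite (bigD1 j) //= leq_addr.
(* Otherwise the norm of [g m] is at least [DD * r ord0 ^+ m]; once [r ord0 ^- m] is at most
   [DD / 2], this is at least 2. *)
have r_le1 : r ord0 <= 1.
  rewrite leNgt; apply/negP => r_gt1.
  pose DD := \prod_j D j; have DD_gt0 : 0 < DD by apply: prodr_gt0.
  have ri_lt1 : (r ord0)^-1 < 1 by rewrite invf_lt1 // (lt_trans ltr01).
  have ri_ge0 : 0 <= (r ord0)^-1 by rewrite invr_ge0 (le_trans ler01).
  have DD2 : 0 < DD / 2 by rewrite divr_gt0.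
  have [M MP] := geometric_small ri_ge0 ri_lt1 DD2.
  pose m := (M + \sum_j N j)%N.
  have := MP m (leq_addr _ _); rewrite exprVn => small.
  have rm_gt0 : 0 < r ord0 ^+ m by rewrite exprn_gt0 // (lt_trans ltr01).
  have : DD * r ord0 ^+ m <= 1.
    apply: le_trans (g_le1 m).
    apply: (@le_trans _ _ (\prod_j (D j * r j ^+ m))).
      rewrite big_split /= ler_wpM2l ?(ltW DD_gt0) //.
      rewrite (bigD1 ord0) //= ler_peMr ?(ltW rm_gt0) //.
      by elim/big_rec: _ => // j x _ x_ge1; rewrite mulr_ege1 ?exprn_ege1.
    apply: ler_prod => j _; rewrite g_ge ?leq_addl // andbT.
    by rewrite mulr_ge0 ?exprn_ge0 // ltW // (lt_le_trans ltr01).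
  rewrite -ler_pdivlMr // mul1r => /le_trans/(_ small); lra.
have [_ _ le_k _] := P ord0.
(* The extreme moduli on the support now agree, and distinct indices have distinct moduli. *)
have supp i : c ord0 i != 0 -> i = k ord0.
  move=> /le_k/andP[le_i i_le]; apply: a_inj; apply/eqP; rewrite eq_le i_le /=.
  by apply: le_trans le_i; move: r_le1; rewrite ler_pdivrMr // mul1r.
have tauFE x : tau ord0 (F x) = c ord0 (k ord0) * sigma (k ord0) x.
  rewrite cE (bigD1 (k ord0)) //= big1 ?addr0 // => i ik.
  have [->|/supp ik'] := eqVneq (c ord0 i) 0; first by rewrite mul0r.
  by rewrite ik' eqxx in ik.
have c1 : c ord0 (k ord0) = 1.
  by have := tauFE 1; rewrite F1 !rmorph1 mulr1.
move=> x y; apply: (fmorph_inj (tau ord0)).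
by rewrite rmorphM /= !tauFE c1 !mul1r rmorphM.
Qed.

(** * Extension from the ring of integers *)

Lemma integer_valMz (K : fieldExtType rat) (x : ringOfIntegers K) d :
  \val (x *~ d) = d%:~R * \val x.
Proof. by rewrite mulrzl (raddfMz (\val : {additive ringOfIntegers K -> K})). Qed.

(** F(x) is f(dx)/d for any nonzero integer d clearing the denominator of [x]; two choices of d are
    compared over their product. *)
Lemma extend_from_integers (K : fieldExtType rat) (V : lmodType rat)
    (f : {additive ringOfIntegers K -> V}) :
  exists F : {additive K -> V}, forall x, F (\val x) = f x.
Proof.
have /choice[m mP] : forall x : K, exists m : int * ringOfIntegers K,
    m.1 != 0 /\ \val m.2 = m.1%:~R * x.
  move=> x; have [d d0 dx_int] := integral_clear_denom x.
  by exists (d, RingOfIntegers dx_int).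
pose F x : V := (m x).1%:~R^-1 *: f (m x).2.
have FE x (d : int) y : d != 0 -> \val y = d%:~R * x -> F x = d%:~R^-1 *: f y.
  move=> d0 yE; have [e0 zE] := mP x; rewrite /F.
  set e := (m x).1 in e0 zE *; set z := (m x).2 in zE *.
  have yz : y *~ e = z *~ d.
    apply: val_inj; rewrite !integer_valMz yE zE !mulrA.
    by congr (_ * _); rewrite mulrC.
  apply: (scalerI (a := (e * d)%:~R)); first by rewrite intr_eq0 mulf_neq0.
  rewrite !scalerA intrM [X in X *: _ = _]mulrAC divff ?intr_eq0 // mul1r.
  by rewrite mulfK ?intr_eq0 // !scaler_int -!(raddfMz f) yz.
have FB : zmod_morphism F.
  move=> x y; have [d0 xE] := mP x; have [e0 yE] := mP y.
  set d := (m x).1 in d0 xE *; set e := (m y).1 in e0 yE *.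
  rewrite (FE _ (d * e) ((m x).2 *~ e - (m y).2 *~ d)) ?mulf_neq0 //.
    rewrite (raddfB f) !(raddfMz f) scalerBr -!scaler_int !scalerA intrM invfM.
    by rewrite mulrVK ?unitfE ?intr_eq0 // mulrAC mulVf ?intr_eq0 // mul1r.
  rewrite (raddfB (\val : {additive ringOfIntegers K -> K})) [LHS]/=.
  rewrite !integer_valMz xE yE intrM mulrBr !mulrA.
  by congr (_ - _); congr (_ * _); rewrite mulrC.
exists (HB.pack F (GRing.isZmodMorphism.Build _ _ F FB) : {additive K -> V}) => x /=.
by rewrite (FE _ 1 x) ?mul1r // invr1 scale1r.
Qed.

Theorem theorem6p1 (R : realType) (K : fieldExtType rat)
    (K_real : totally_real R K)
    (s : nat) (L : 'I_s -> fieldExtType rat)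
    (A : {additive ringOfIntegers K -> etaleRingOfIntegers L})
    (A_units : forall u : ringOfIntegers K, invertible u -> invertible (A u)) :
  exists (tau : {rmorphism K -> etale L}) (eps : etaleRingOfIntegers L),
    [/\ scalable tau, invertible eps &
        forall x : ringOfIntegers K, \val (A x) = \val eps * tau (\val x)].
Proof.
have [eta eps_eta] : invertible (A 1).
  by apply: A_units; exists 1; rewrite mulr1.
have [F FE] := extend_from_integers (\val \o A : {additive ringOfIntegers K -> etale L}).
pose eps' : etale L := \val eta.
have eps'K : \val (A 1) * eps' = 1.
  by rewrite -rmorphM eps_eta rmorph1.
have eps'i i : \val (A 1) i * eps' i = 1 by rewrite -etaleME eps'K etale1E.
pose T x : etale L := eps' * F x.
have TB : zmod_morphism T by move=> x y; rewrite /T raddfB mulrBr.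
have T1 : T 1 = 1.
  by rewrite /T -(rmorph1 (\val : {rmorphism ringOfIntegers K -> K})) FE mulrC.
have TM : {morph T : x y / x * y}.
  (* Multiplicativity is checked in each factor [L i], where the number field case applies. *)
  move=> x y; apply/ffunP=> i; rewrite [RHS]etaleME.
  pose Ti z : L i := T z i.
  have TiB : zmod_morphism Ti by move=> z w; rewrite /Ti TB etaleDE etaleNE.
  pose TiA : {additive K -> L i} := HB.pack Ti (GRing.isZmodMorphism.Build _ _ Ti TiB).
  suff TiM : {morph TiA : z w / z * w}.
    exact: TiM.
  apply: (unit_preserving_multiplicative K_real) => [|u u0 u_int uV_int].
    by rewrite /= /Ti T1 etale1E.
  have [v Auv] : invertible (A (RingOfIntegers u_int)).
    apply: A_units; exists (RingOfIntegers uV_int); apply: val_inj.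
    by rewrite rmorphM rmorph1 /= divff.
  have Auv1 : \val (A (RingOfIntegers u_int)) * \val v = 1 :> etale L.
    by rewrite -rmorphM Auv rmorph1.
  (* This exhibits the inverse of [Ti u] as a product of two integral elements. *)
  have TiE : Ti u * (\val (A 1) i * \val v i) = 1.
    rewrite /Ti /T etaleME (FE (RingOfIntegers u_int)) /= mulrACA [eps' i * _]mulrC.
    rewrite eps'i mul1r.
    by rewrite -[LHS]etaleME Auv1 etale1E.
  have Tu0 : Ti u != 0.
    by apply/eqP=> Tu0; move/eqP: TiE; rewrite Tu0 mul0r eq_sym oner_eq0.
  split=> //=; rewrite -[_^-1]mulr1 -TiE mulKf // rpredM //.
    by have /forallP/(_ i) := valP (A 1).
  by have /forallP/(_ i) := valP v.
pose TA := GRing.isZmodMorphism.Build _ _ T TB.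
pose TMm := GRing.isMonoidMorphism.Build _ _ T (conj T1 TM).
exists (HB.pack T TA TMm : {rmorphism K -> etale L}), (A 1); split.
- exact: rat_linear TB.
- by exists eta.
- by move=> x; rewrite /= /T mulrA eps'K mul1r FE.
Qed.
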